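(* Formulation F6 is strictly tighter than Formulation F1 (both defined in the context). Explicitly, writing $X(S)_{t,m}=\sum_{t'=t-W_m+1}^{t}S_{t',m}$ for $t\in T$, $m\in M$: (i) for every instance $(T,M,(W_m)_{m\in M})$ and every continuous solution $S$ of F6, the pair $(X(S),S)$ is a continuous solution of F1; and (ii) there exist an instance and a continuous solution $(X,S)$ of F1 for that instance such that it is not the case that $S$ is a continuous solution of F6 with $X=X(S)$.
   Context: An instance of the generator maintenance scheduling problem consists of a horizon $T=\{1,2,\dots,|T|\}$ of periods, a finite nonempty set $M$ of maintenances, and a positive integer duration $W_m$ for each $m\in M$. The variables are $X_{t,m}$ (maintenance $m$ is executed in period $t$) and $S_{t,m}$ (maintenance $m$ starts in period $t$), for $t\in T$, $m\in M$. Conventions: $X_{t,m}=0$ whenever $t\le 0$ or $t>|T|$; $S_{t,m}=0$ whenever $t\le 0$, $t>|T|$, or $t\ge |T|-W_m+2$ (a maintenance cannot start so late that it would not finish within the horizon). In particular every solution is required to satisfy $S_{t,m}=0$ for $t\in T$ with $t\ge |T|-W_m+2$. Formulation F1 (variables $X,S$): $\sum_{t\in T}X_{t,m}=W_m$ for all $m\in M$; $\sum_{t\in T}S_{t,m}=1$ for all $m\in M$; $X_{t,m}-X_{t-1,m}\le S_{t,m}$ for all $t\in T$, $m\in M$; $X_{t,m},S_{t,m}\in\{0,1\}$ for all $t\in T$, $m\in M$. Formulation F6 (variables $S$ only): $\sum_{t\in T}S_{t,m}=1$ for all $m\in M$; $S_{t,m}\in\{0,1\}$ for all $t\in T$, $m\in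 M$. In F6 the execution variable is not explicit: the expression $\sum_{t'=t-W_m+1}^{t}S_{t',m}$ is used wherever $X_{t,m}$ would appear. A continuous solution of a formulation is a real assignment of its variables satisfying its linear relaxation, i.e. all its constraints with each condition ''$\in\{0,1\}$'' replaced by ''$\in[0,1]$''. A formulation A is at least as tight as B if all continuous solutions satisfying A also satisfy B; A is strictly tighter than B if A is at least as tight as B and there is at least one continuous solution satisfying B that does not satisfy A. A pair $(X,S)$ is regarded as satisfying F6 when $S$ is a continuous solution of F6 and $X$ is given by the expression above. *)

(* Defs.v *)
From mathcomp Require Import all_boot all_order all_algebra.
From mathcomp Require Import reals.

Set Implicit Arguments.
Unset Strict Implicit.
Unset Printing Implicit Defensive.

Import Order.TTheory GRing.Theory Num.Theory.
Local Open Scope ring_scope.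

Record instance := Instance {
  horizon : nat;                          (* |T| *)
  maint : finType;                        (* M *)
  duration : maint -> nat;                (* W *)
  maint_nonempty : (0 < #|maint|)%N;
  duration_gt0 : forall m, (0 < duration m)%N }.

Definition in_horizon (I : instance) (t : nat) : bool :=
  (1 <= t <= horizon I)%N.

(* Variables are indexed by all t : nat, so that X_{t-1} and the window sums
   make sense; the conventions force them to vanish outside T. *)
Definition assignment (R : realType) (I : instance) := nat -> maint I -> R.

Definition execution_convention (R : realType) (I : instance)
    (X : assignment R I) : Prop :=
  forall t m, ~~ in_horizon I t -> X t m = 0.

(* t >= |T| - W_m + 2 is written without (truncated) subtraction. *)
Definition start_convention (R : realType) (I : instance)
    (S : assignment R I) : Prop :=
  forall t m,
    ~~ in_horizon I t || (horizon I + 2 <= t + duration m)%N -> S t m = 0.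

(* X(S)_{t,m}, the sum of S_{t',m} over t' = t - W_m + 1, ..., t.  When
   t - W_m + 1 < 0 the lower bound is truncated to 0, which only drops
   indices t' < 0, for which S_{t',m} = 0 by convention. *)
Definition execution (R : realType) (I : instance) (S : assignment R I) :
    assignment R I :=
  fun t m => if in_horizon I t
             then \sum_((t.+1 - duration m)%N <= t' < t.+1) S t' m
             else 0.

(* A formulation is parameterized by the set D in which its binary variables
   range: D = {0,1} gives the integer formulation, D = [0,1] its linear
   relaxation. *)
Definition formulation (R : realType) :=
  {pred R} -> forall I : instance, assignment R I -> assignment R I -> Prop.

Definition F1 (R : realType) : formulation R := fun D I X S =>
  [/\ execution_convention X, start_convention S &
      [/\ forall m,
            \sum_(1 <= t < (horizon I).+1) X t m = (duration m)%:R,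
          forall m, \sum_(1 <= t < (horizon I).+1) S t m = 1,
          forall t m, in_horizon I t -> X t m - X t.-1 m <= S t m &
          forall t m, in_horizon I t -> (X t m \in D) && (S t m \in D)]].

Definition F6_start (R : realType) (D : {pred R}) (I : instance)
    (S : assignment R I) : Prop :=
  [/\ start_convention S,
      forall m, \sum_(1 <= t < (horizon I).+1) S t m = 1 &
      forall t m, in_horizon I t -> S t m \in D].

Definition F6 (R : realType) : formulation R := fun D I X S =>
  F6_start D S /\ X =2 execution S.

Definition continuous_solution (R : realType) (F : formulation R)
    (I : instance) (X S : assignment R I) : Prop :=
  F [pred x | 0 <= x <= 1] I X S.

Definition at_least_as_tight (R : realType) (A B : formulation R) : Prop :=
  forall (I : instance) (X S : assignment R I),
    continuous_solution A X S -> continuous_solution B X S.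

Definition strictly_tighter (R : realType) (A B : formulation R) : Prop :=
  at_least_as_tight A B /\
  exists (I : instance) (X S : assignment R I),
    continuous_solution B X S /\ ~ continuous_solution A X S.

(* Main.v *)
Require Import Defs.
From mathcomp Require Import all_boot all_order all_algebra.
From mathcomp Require Import reals.
From mathcomp Require Import zify lra.

(** Write X(S)_t for the sum of the starts over the window (t - W, t].

    F6 implies F1.  The sum of X(S)_t over t counts each start S_s once for
    every period t in [s, s + W).  A start that does not vanish leaves room for
    the whole run [s, s + W) inside the horizon, so it is counted exactly W
    times; as the starts add up to 1, the total execution is W.  Sliding the
    window from t - 1 to t adds S_t and drops the nonnegative S_(t - W), hence
    X(S)_t - X(S)_(t-1) <= S_t.  Finally X(S)_t is a partial sum of
    nonnegative terms of total 1, hence lies in [0, 1].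

    The inclusion is strict because F1 bounds the increase of X from above by
    S but never forces X to rise when a start occurs.  With two periods and
    one maintenance of duration 1, one may start fully in period 1 while
    spreading the execution evenly over both periods. *)

Set Implicit Arguments.
Unset Strict Implicit.
Unset Printing Implicit Defensive.

Import Order.TTheory GRing.Theory Num.Theory.
Local Open Scope ring_scope.

Section ExecutionOfStarts.

Variables (R : realType) (I : instance) (S : assignment R I).
Hypothesis S_conv : start_convention S.

Lemma start_out t m : ~~ in_horizon I t -> S t m = 0.
Proof. by move=> tI; apply: S_conv; rewrite tI. Qed.

(** Summing over a range independent of t, with the window as a filter, makes
    X(S) a partial sum of the total of the starts and allows exchanging the
    sums over t and over start periods. *)
Lemma execution_filter t m : in_horizon I t ->
  execution S t m =
  \sum_(1 <= s < (horizon I).+1 | (s <= t < s + duration m)%N) S s m.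
Proof.
move=> tI; have /andP[_ t_le] := tI.
rewrite /execution tI.
rewrite (big_nat_widenl _ 0) // (big_nat_widen _ _ (horizon I).+1) ?ltnS //.
rewrite [RHS](big_nat_widenl _ 0) // big_mkcond [RHS]big_mkcond.
apply: eq_bigr => s _ /=; have Wgt0 := duration_gt0 m.
(* The truncated lower bound may reach index 0, where no start occurs. *)
case: s => [|s]; last by rewrite andbT; congr (if _ then _ else _); lia.
by rewrite start_out // if_same andbF.
Qed.

Lemma sum_execution m :
  \sum_(1 <= t < (horizon I).+1) S t m = 1 ->
  \sum_(1 <= t < (horizon I).+1) execution S t m = (duration m)%:R.
Proof.
move=> sumS.
have -> : (duration m)%:R =
    \sum_(1 <= s < (horizon I).+1) S s m * (duration m)%:R.
  by rewrite -mulr_suml sumS mul1r.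
under eq_big_nat => t tI do rewrite execution_filter //.
rewrite (exchange_big_dep xpredT) //=.
apply: eq_big_nat => s /andP[s_gt0 s_le].
have [fits|late] := ltnP (s + duration m) (horizon I + 2).
  (* The whole run [s, s + W) lies in the horizon. *)
  rewrite mulr_natr -[X in _ *+ X](addKn s) -sumr_const_nat.
  rewrite [RHS](big_nat_widen _ _ (horizon I).+1); last by lia.
  rewrite [RHS](big_nat_widenl _ 1) //.
  by apply: eq_bigl => t; rewrite andbC.
by rewrite S_conv ?late ?orbT // mul0r big1.
Qed.

Hypothesis S_ge0 : forall t m, 0 <= S t m.

Lemma execution_step t m : in_horizon I t ->
  execution S t m - execution S t.-1 m <= S t m.
Proof.
case: t => [//|t] tI; have Wgt0 := duration_gt0 m.
have -> : execution S t m = \sum_(t.+1 - duration m <= s < t.+1) S s m.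
  rewrite /execution; case: ifP => // tN.
  (* This is period 0, whose window only contains the index 0. *)
  have t0 : t = 0%N by move: tI tN; rewrite /in_horizon; lia.
  rewrite t0 big_nat_cond big1 // => s ?.
  by apply: start_out; rewrite /in_horizon; lia.
rewrite /execution tI big_nat_recr /=; last by lia.
rewrite (@big_cat_nat _ _ _ (t.+2 - duration m) (t.+1 - duration m)) /=;
  try lia.
have : 0 <= \sum_(t.+1 - duration m <= s < t.+2 - duration m) S s m.
  by apply: sumr_ge0.
lra.
Qed.

Lemma execution_itv01 t m :
  \sum_(1 <= s < (horizon I).+1) S s m = 1 -> in_horizon I t ->
  0 <= execution S t m <= 1.
Proof.
move=> sumS tI; rewrite execution_filter // sumr_ge0 //= -sumS big_mkcond.
by apply: ler_sum => s _; case: ifP.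
Qed.

End ExecutionOfStarts.

Lemma F6_tighter_F1 (R : realType) : at_least_as_tight (@F6 R) (@F1 R).
Proof.
move=> I X S [[S_conv sumS S01] XE].
have S_ge0 t m : 0 <= S t m.
  have [/(S01 t m)/andP[]//|tN] := boolP (in_horizon I t).
  by rewrite start_out.
split=> //; first by move=> t m tN; rewrite XE /execution (negPf tN).
split=> // [m|t m tI|t m tI].
- by under eq_bigr do rewrite XE; exact: sum_execution.
- by rewrite !XE; exact: execution_step.
- by rewrite XE S01 // andbT; exact: execution_itv01.
Qed.

Definition two_period_instance : instance :=
  @Instance 2 unit (fun=> 1%N) (ltac:(by rewrite card_unit)) (fun=> isT).

Definition early_start (R : realType) : assignment R two_period_instance :=
  fun t _ => (t == 1%N)%:R.

Definition even_execution (R : realType) : assignment R two_period_instance :=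
  fun t _ => if in_horizon two_period_instance t then 2^-1 else 0.

Lemma even_execution_F1 (R : realType) :
  continuous_solution (@F1 R) (@even_execution R) (@early_start R).
Proof.
split; first by move=> t m; rewrite /even_execution => /negPf ->.
  by move=> [|[|[|t]]].
split=> [m|m|t m|t m].
- by rewrite big_ltn // big_ltn // big_geq // /even_execution /=; lra.
- by rewrite big_ltn // big_ltn // big_geq // /early_start /=; lra.
- by case: t => [|[|[|t]]] // _; rewrite /even_execution /early_start /=; lra.
- case: t => [|[|[|t]]] // _; rewrite /even_execution /early_start !inE /=;
    by apply/andP; split; lra.
Qed.

Lemma even_execution_not_F6 (R : realType) :
  ~ continuous_solution (@F6 R) (@even_execution R) (@early_start R).
Proof.
case=> _ /(_ 1%N tt).
(* In period 1 the window sum is 1, whereas only half is executed. *)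
by rewrite /even_execution /execution /= big_nat1 /early_start /=; lra.
Qed.

Theorem corollary3p1 (R : realType) : strictly_tighter (@F6 R) (@F1 R).
Proof.
split; first exact: F6_tighter_F1.
exists two_period_instance, (@even_execution R), (@early_start R).
by split; [exact: even_execution_F1 | exact: even_execution_not_F6].
Qed.
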